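(* For every fixed $\varepsilon\in(0,0.9]$ and every integer $\ell\geq 2$, for every $\varepsilon$-excessive tolerance vector $\Lambda=(\alpha_1,\alpha_2,\ldots,\alpha_\ell)$ and any graph $G$ with a $\Lambda$-list assignment $L$ together with the corresponding $\Lambda$-tolerance function $\alpha$, if $\delta(G)\geq\left\lceil 109\,\ell\,\varepsilon^{-2}\ln(\ell\varepsilon^{-1})\right\rceil$, then there is an $\alpha$-majority $L$-colouring of $G$.
   Context: A graph $G=(V,E)$ means a finite simple graph; $\delta(G)$ is its minimum degree and $d(v)$ the degree of $v$. For $\varepsilon>0$, an $\varepsilon$-excessive tolerance vector is a vector $\Lambda=(\alpha_1,\ldots,\alpha_\ell)$ of (not necessarily pairwise distinct) real numbers $\alpha_i\in(0,1)$ with $\sum_{i=1}^{\ell}\alpha_i=1+\varepsilon$. Given a set of colours $C$, a $\Lambda$-tolerance function is a function $\alpha:C\to(0,1)$ assigning to every colour in $C$ one of the entries $\alpha_i$ of $\Lambda$. A $\Lambda$-list (with respect to $\alpha$) is a list $(c_1,\ldots,c_\ell)$ of $\ell$ pairwise distinct colours of $C$ such that $\alpha(c_i)=\alpha_i$ for $i=1,\ldots,\ell$ (regarded also as a subset of $C$). A $\Lambda$-list assignment of $G$ is a function $L:E\to 2^C$ such that $L(e)$ is a $\Lambda$-list for every $e\in E$. An $\alpha$-majority $L$-colouring of $G$ is a (not necessarily proper) edge colouring $\omega:E\to C$ such that $\omega(e)\in L(e)$ for every $e\in E$ and, for every vertex $v\in V$ and every colour $c\in C$, the number of edges incident with $v$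 that are coloured $c$ by $\omega$ is at most $\alpha(c)d(v)$. *)

(* Defs.v *)
From mathcomp Require Import all_boot all_order all_algebra.
From mathcomp Require Import reals exp.
Set Implicit Arguments.
Unset Strict Implicit.
Unset Printing Implicit Defensive.
Import Order.TTheory GRing.Theory Num.Theory.
Local Open Scope ring_scope.

Record sgraph := SGraph {
  vertex : finType;
  edge_set : {set {set vertex}};
  edge_setP : forall e, e \in edge_set -> #|e| = 2%N
}.

Definition edge (G : sgraph) := {e : {set vertex G} | e \in edge_set G}.

Definition degree (G : sgraph) (v : vertex G) : nat :=
  #|[set e : edge G | v \in val e]|.

(* In a simple graph every degree is less than the number of vertices, so the
   default #|vertex G| is irrelevant unless G has no vertex, in which case the
   minimum degree is 0. *)
Definition min_degree (G : sgraph) : nat :=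
  \big[minn/#|vertex G|]_(v : vertex G) degree v.

Section Tolerance.
Variables (R : realType) (l : nat).

Definition excessive (eps : R) (Lambda : l.-tuple R) : Prop :=
  (forall i, 0 < tnth Lambda i < 1) /\ \sum_(i < l) tnth Lambda i = 1 + eps.

Variable C : eqType.

(* Values lie in (0, 1) as soon as Lambda is excessive. *)
Definition tolerance_function (Lambda : l.-tuple R) (alpha : C -> R) : Prop :=
  forall c, alpha c \in Lambda.

Definition Lambda_list (Lambda : l.-tuple R) (alpha : C -> R)
    (s : l.-tuple C) : Prop :=
  uniq s /\ forall i, alpha (tnth s i) = tnth Lambda i.

Definition Lambda_list_assignment (Lambda : l.-tuple R) (alpha : C -> R)
    (G : sgraph) (L : edge G -> l.-tuple C) : Prop :=
  forall e, Lambda_list Lambda alpha (L e).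

Definition majority_colouring (alpha : C -> R) (G : sgraph)
    (L : edge G -> l.-tuple C) (omega : edge G -> C) : Prop :=
  (forall e, omega e \in L e) /\
  (forall (v : vertex G) (c : C),
     #|[set e : edge G | (v \in val e) && (omega e == c)]|%:R
       <= alpha c * (degree v)%:R).

End Tolerance.

(* Main.v *)
Require Import Defs.
From mathcomp Require Import all_boot all_order all_algebra.
From mathcomp Require Import reals exp.
From mathcomp Require Import zify ring lra.
Set Implicit Arguments.
Unset Strict Implicit.
Unset Printing Implicit Defensive.
Import Order.TTheory GRing.Theory Num.Theory.
Local Open Scope ring_scope.

(** The proof is deterministic: it rounds a fractional colouring by the
    iterated linear-algebra method of Beck and Fiala.

    Give the [i]-th colour of every list the same weight [p i], where [p] is a
    probability distribution with [p i <= alpha_i - eps / l] whenever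
    [p i > 0].  Such a [p] exists because lowering all [l] tolerances by
    [eps / l] leaves a total of [1 + eps - eps = 1] ([shifted_distribution]).
    At a vertex [v] each edge carries the colour [c] at most once, so the
    fractional load of [c] at [v] is at most [(alpha c - eps / l) * d(v)].

    Next, the fractional colouring is rounded to a genuine one in such a way
    that no load of a colour at a vertex grows by more than 4
    ([selection_with_sparse_loads]).  The variables are the pairs (edge,
    position in its list); the point is that a variable enters only two loads,
    one per endpoint of its edge.  As long as some variable lies strictly
    between 0 and 1, consider the constraints that every edge has total weight
    1 and that each load with more than 4 fractional variables is preserved.
    An edge with a fractional variable has at least two of them, so with [n]
    fractional variables there are at most [n / 2] constraints of the first
    kind and at most [2 n / 5] of the second, fewer than [n] in all
    ([few_active_constraints]).  The system has a nonzero solution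
    ([underdetermined_system]), and following it until a variable hits 0 or 1
    ([walk_to_face]) lowers [n].  A load is abandoned only when at most 4
    fractional variables remain in it, and from then on it grows by at most 4.

    Finally the loss of 4 fits into the slack [eps / l * d(v)], because
    [d(v) >= 109 l eps^-2 ln (l / eps)] exceeds [4 l / eps]
    ([slack_dominates_loss]).  Colours of weight 0 are never chosen, so a
    tolerance below [eps / l] causes no harm. *)

(** * Moving inside the unit cube *)

(** A matrix with more rows than columns has a nonzero left kernel. *)
Lemma underdetermined_system (F : fieldType) (I J : finType)
    (A : {set I}) (B : {set J}) (a : I -> J -> F) :
  (#|B| < #|A|)%N ->
  exists z : I -> F,
    [/\ exists i, z i != 0, forall i, i \notin A -> z i = 0
      & forall j, j \in B -> \sum_(i in A) z i * a i j = 0].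
Proof.
move=> ltBA.
pose M := \matrix_(i < #|A|, j < #|B|) a (enum_val i) (enum_val j).
have kerM0 : kermx M != 0.
  rewrite -mxrank_eq0 mxrank_ker -lt0n subn_gt0.
  exact: leq_ltn_trans (rank_leq_col M) ltBA.
have : nz_row (kermx M) != 0 by rewrite nz_row_eq0.
move: (nz_row_sub (kermx M)) => /sub_kermxP; move: (nz_row _) => u uM0.
case/rV0Pn => i0 ui0; have Ai0 := enum_valP i0.
pose z i := if i \in A then u 0 (enum_rank_in Ai0 i) else 0.
have zE i : z (enum_val i) = u 0 i by rewrite /z enum_valP enum_valK_in.
exists z; split; first by exists (enum_val i0); rewrite zE.
  by move=> i /negbTE Ai; rewrite /z Ai.
move=> j Bj; rewrite big_enum_val.
transitivity ((u *m M) 0 (enum_rank_in Bj j)); last by rewrite uM0 mxE.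
rewrite mxE; by apply: eq_bigr => i _; rewrite zE mxE enum_rankK_in.
Qed.

Section Rounding.
Variables (R : realFieldType) (T : finType).
Implicit Types x z : T -> R.

Definition fractional x := [set t | 0 < x t < 1].

Lemma fractionalPn x t : 0 <= x t <= 1 ->
  reflect (x t = 0 \/ x t = 1) (t \notin fractional x).
Proof.
move=> /andP[x0 x1]; rewrite inE !lt_neqAle x0 x1 !andbT negb_and !negbK eq_sym.
by apply: (iffP orP) => -[/eqP|/eqP]; auto.
Qed.

(** The step length is the smallest ratio at which a coordinate moved by [z]
    meets the boundary of the cube.  That coordinate stops being fractional,
    and no other becomes fractional since [z] fixes the integral ones. *)
Lemma walk_to_face x z :
    (forall t, 0 <= x t <= 1) -> (exists t, z t != 0) ->
    (forall t, t \notin fractional x -> z t = 0) ->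
  exists s, let x' t := x t + s * z t in
    (forall t, 0 <= x' t <= 1) /\ fractional x' \proper fractional x.
Proof.
move=> hx [t1 zt1] zF.
pose r t := if 0 < z t then (1 - x t) / z t else - x t / z t.
have [t0 /= zt0 r_min] := arg_minP r (zt1 : (fun t => z t != 0) t1).
have r_ge0 : 0 <= r t0.
  rewrite /r; have /andP[x0 x1] := hx t0; case: ltrP => h.
    by rewrite divr_ge0 ?subr_ge0 // ltW.
  by rewrite mulNr -mulrN -invrN mulr_ge0 // invr_ge0 oppr_ge0.
have rz t : z t != 0 -> r t * z t = if 0 < z t then 1 - x t else - x t.
  by rewrite /r => zt; case: ifP => _; rewrite mulfVK.
exists (r t0) => /=.
have box t : 0 <= x t + r t0 * z t <= 1.
  have /andP[x0 x1] := hx t; have [->|zt] := eqVneq (z t) 0.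
    by rewrite mulr0 addr0 x0.
  have := r_min t zt; have := rz t zt; case: ltrP => h e m.
    have a1 : 0 <= r t0 * z t by rewrite mulr_ge0 // ltW.
    have a2 : r t0 * z t <= r t * z t by rewrite ler_pM2r.
    lra.
  have a1 : r t0 * z t <= 0 by rewrite mulr_ge0_le0.
  have a2 : r t * z t <= r t0 * z t by rewrite ler_wnM2r.
  lra.
split=> //; apply/properP; split.
  apply/subsetP => t; apply: contraLR => tF.
  by rewrite inE zF // mulr0 addr0; rewrite inE in tF.
exists t0; first by apply: contraR zt0 => /zF ->.
rewrite inE (rz _ zt0); case: ifP => _; first by rewrite subrKC ltxx andbF.
by rewrite subrr ltxx.
Qed.

(** Were [x t] the only fractional summand, the other summands would be
    integers adding up to [1 - x t], which is not an integer. *)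
Lemma two_fractional_summands (P : pred T) x t :
    (forall t, 0 <= x t <= 1) -> \sum_(t | P t) x t = 1 ->
    P t -> t \in fractional x ->
  (1 < #|[set t in fractional x | P t]|)%N.
Proof.
move=> hx sum1 Pt tF; rewrite ltnNge; apply/negP => le1.
have other t' : P t' -> t' != t -> x t' = 0 \/ x t' = 1.
  move=> Pt' ne; apply/fractionalPn => //; apply: contra ne => t'F.
  by apply/eqP/(card_le1_eqP le1); rewrite inE ?t'F ?tF.
move: tF; rewrite inE => /andP[xt0 xt1].
have [|] := boolP [exists t', [&& P t', t' != t & x t' == 1]].
  case/existsP=> t' /and3P[Pt' ne /eqP xt'].
  move: sum1; rewrite (bigD1 t) //= (bigD1 t') ?Pt' //= xt'.
  have : 0 <= \sum_(i | P i && (i != t) && (i != t')) x i.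
    by apply: sumr_ge0 => i _; case/andP: (hx i).
  lra.
move=> /existsPn none; move: sum1; rewrite (bigD1 t) //= big1 ?addr0.
  by move=> e; rewrite e ltxx in xt1.
move=> t' /andP[Pt' ne]; have [//|/eqP e] := other t' Pt' ne.
by have := none t'; rewrite Pt' ne e.
Qed.

(** * Rounding with sparse loads *)

(* The fibres of [g] are the groups in which exactly one element is to be
   selected; [S] is the family of sets whose loads are to be controlled. *)
Variables (E K : finType) (g : T -> E) (S : K -> {set T}) (D : nat).
Hypothesis sparse : forall t, (#|[set k | t \in S k]| <= D)%N.

(** Each group touched by [fractional x] contains two fractional elements, and
    sparsity bounds the number of incidences between fractional elements and
    load sets by [D * #|fractional x|].  The threshold [2 * D] is the least
    one for which the two resulting bounds add up to less than the number of
    unknowns. *)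
Lemma few_active_constraints x :
    (forall t, 0 <= x t <= 1) -> (forall e, \sum_(t | g t == e) x t = 1) ->
    fractional x != set0 ->
  (#|g @: fractional x| + #|[set k | 2 * D < #|S k :&: fractional x|]|
    < #|fractional x|)%N.
Proof.
move=> hx hg; rewrite -card_gt0; set F := fractional x; set K' := [set k | _].
move=> F0.
have groups : (2 * #|g @: F| <= #|F|)%N.
  rewrite mulnC -sum_nat_const -[#|F|]sum1_card (partition_big_imset g) /=.
  apply: leq_sum => _ /imsetP[t tF ->].
  have := @two_fractional_summands (fun t' => g t' == g t) x t hx (hg _).
  by rewrite -sum1dep_card; apply; rewrite ?eqxx.
have loads : ((2 * D).+1 * #|K'| <= D * #|F|)%N.
  apply: (@leq_trans (\sum_(k in K') #|S k :&: F|)).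
    by rewrite mulnC -sum_nat_const leq_sum // => k; rewrite inE.
  apply: (@leq_trans (\sum_k \sum_(t in F | t \in S k) 1)).
    rewrite [X in (_ <= X)%N](bigID (mem K')) /=.
    apply: leq_trans (leq_addr _ _); apply: leq_sum => k _.
    by rewrite setIC -sum1_card (eq_bigl _ _ (fun t => in_setI t _ _)).
  rewrite (exchange_big_dep (mem F)) /=; last by move=> k t _ /andP[].
  rewrite mulnC -sum_nat_const.
  apply: leq_sum => t _; rewrite sum1dep_card; apply: leq_trans (sparse t).
  by apply/subset_leq_card/subsetP => k; rewrite !inE => /andP[].
by move: F0 groups loads; nia.
Qed.

(** Induction on the number of fractional variables.  That integral values are
    respected by the rounding (the first two clauses) is what lets the
    induction forget a load set with few fractional elements: only these can
    change, each by less than 1. *)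
Lemma round_with_sparse_loads x :
    (forall t, 0 <= x t <= 1) -> (forall e, \sum_(t | g t == e) x t = 1) ->
  exists Y : {set T},
    [/\ forall t, t \in Y -> 0 < x t,
        forall t, x t = 1 -> t \in Y,
        forall e, #|[set t in Y | g t == e]| = 1%N
      & forall k, #|S k :&: Y|%:R <= \sum_(t in S k) x t + (2 * D)%:R].
Proof.
have [n] := ubnP #|fractional x|;
  elim: n => // n IH in x * => /ltnSE ltFn hx hg.
have cardE (A Y : {set T}) : #|A :&: Y|%:R = \sum_(t in A) (t \in Y)%:R :> R.
  rewrite -sum1_card natr_sum (eq_bigl _ _ (fun t => in_setI t _ _)).
  by rewrite big_mkcondr /=; apply: eq_bigr => t _; case: (t \in Y).
have [F0|Fn0] := eqVneq (fractional x) set0.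
  pose Y := [set t | x t == 1]; exists Y.
  have YE t : (t \in Y)%:R = x t.
    have /fractionalPn : t \notin fractional x by rewrite F0 inE.
    by rewrite inE => /(_ (hx t))[] ->; rewrite ?eqxx // eq_sym oner_eq0.
  split.
  - by move=> t; rewrite inE => /eqP ->; rewrite ltr01.
  - by move=> t xt; rewrite inE xt.
  - move=> e; apply/eqP; rewrite -(eqr_nat R); apply/eqP.
    rewrite -sum1dep_card natr_sum -[RHS](hg e) big_mkcondl /=.
    by apply: eq_bigr => t _; rewrite -YE; case: (t \in Y).
  - by move=> k; rewrite cardE (eq_bigr _ (fun t _ => YE t)) lerDl ler0n.
(* [inl e] stands for the total weight of the group [e], [inr k] for the load
   of [S k] while it is still protected. *)
pose B : {set E + K} := inl @: (g @: fractional x)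
  :|: inr @: [set k | 2 * D < #|S k :&: fractional x|]%N.
pose a t (j : E + K) : R :=
  match j with inl e => (g t == e)%:R | inr k => (t \in S k)%:R end.
have ltBF : (#|B| < #|fractional x|)%N.
  apply: leq_ltn_trans (few_active_constraints hx hg Fn0).
  by rewrite (leq_trans (leq_card_setU _ _)) // leq_add ?leq_imset_card.
have [z [zn0 zF zB]] := underdetermined_system a ltBF.
have zsum (P : pred T) (b : T -> R) : b =1 (fun t => (P t)%:R) ->
    \sum_(t in fractional x) z t * b t = 0 -> \sum_(t | P t) z t = 0.
  move=> bE sum0; rewrite -[RHS]sum0 big_mkcond [RHS]big_mkcond.
  apply: eq_bigr => t _ /=.
  have [_|/zF ->] := boolP (t \in fractional x); last by rewrite if_same.
  by rewrite bE; case: (P t); rewrite ?mulr1 ?mulr0.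
have [s] := walk_to_face hx zn0 zF.
set x' := fun t => _ => /= -[hx' ltF].
have moved (P : pred T) : \sum_(t | P t) z t = 0 ->
    \sum_(t | P t) x' t = \sum_(t | P t) x t.
  by move=> z0; rewrite big_split /= -mulr_sumr z0 mulr0 addr0.
have hg' e : \sum_(t | g t == e) x' t = 1.
  rewrite moved //; have [eF|eF] := boolP (e \in g @: fractional x).
    apply: (zsum _ (fun t => a t (inl e))) => //; apply: zB.
    by rewrite inE imset_f.
  rewrite big1 // => t /eqP gt; apply: zF; apply: contra eF => tF.
  by rewrite -gt imset_f.
have ltFn' := leq_trans (proper_card ltF) ltFn.
have [Y [Ypos Yone Yg Yload]] := IH x' ltFn' hx' hg'.
have fixed t : t \notin fractional x -> x' t = x t.
  by move=> /zF; rewrite /x' => ->; rewrite mulr0 addr0.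
have Yint t : t \notin fractional x -> (t \in Y)%:R = x t.
  move=> tF; have /fractionalPn : t \notin fractional x by [].
  move=> /(_ (hx t))[] xt; rewrite xt.
    by case: (boolP (t \in Y)) => // /Ypos; rewrite fixed // xt ltxx.
  by rewrite Yone // fixed.
exists Y; split=> //.
- move=> t tY; have [|tF] := boolP (t \in fractional x).
    by rewrite inE => /andP[].
  by rewrite -(Yint t tF) tY ltr01.
- by move=> t xt; apply: Yone; rewrite fixed // inE xt ltxx andbF.
move=> k; have [kB|kB] := ltnP (2 * D) #|S k :&: fractional x|.
  rewrite -(moved (fun t => t \in S k)) ?Yload //.
  apply: (zsum _ (fun t => a t (inr k))) => //; apply: zB.
  by rewrite inE orbC imset_f // inE.
(* The load of [S k] is no longer protected. *)
apply: (@le_trans _ _ (\sum_(t in S k) x t + #|S k :&: fractional x|%:R)).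
  rewrite !cardE -big_split /=; apply: ler_sum => t _.
  have [tF|tF] := boolP (t \in fractional x); last by rewrite Yint ?addr0.
  have /andP[x0 x1] := hx t; case: (t \in Y) => /=; lra.
by rewrite lerD2l ler_nat.
Qed.

Lemma selection_with_sparse_loads x :
    (forall t, 0 <= x t <= 1) -> (forall e, \sum_(t | g t == e) x t = 1) ->
  exists f : E -> T,
    [/\ forall e, g (f e) = e, forall e, 0 < x (f e)
      & forall k, #|[set e | f e \in S k]|%:R
          <= \sum_(t in S k) x t + (2 * D)%:R].
Proof.
move=> hx hg; have [Y [Ypos _ Yg Yload]] := round_with_sparse_loads hx hg.
have pick e : exists t, (t \in Y) && (g t == e).
  have /eqP/cards1P[t /setP/(_ t)] := Yg e.
  by rewrite !inE eqxx => tY; exists t.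
pose f e := xchoose (pick e).
have fY e : f e \in Y by have /andP[] := xchooseP (pick e).
have gf e : g (f e) = e by have /andP[_ /eqP] := xchooseP (pick e).
exists f; split=> [//|e|k]; first exact: Ypos.
apply: le_trans (Yload k); rewrite ler_nat -(card_imset _ (can_inj gf)).
apply/subset_leq_card/subsetP => _ /imsetP[e eS ->].
by rewrite !inE fY andbT in eS *.
Qed.

End Rounding.

(** * Majority colourings *)

Lemma min_degree_le (G : sgraph) (v : vertex G) : (min_degree G <= degree v)%N.
Proof.
rewrite /min_degree; have := mem_index_enum v.
elim: (index_enum _) => //= u s IH.
rewrite inE big_cons => /orP[/eqP -> | /IH]; first exact: geq_minl.
exact/leq_trans/geq_minr.
Qed.

(** As [ln y >= 1 - 1 / y] and [l / eps >= 2], the logarithm is at least 1/2,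
    which leaves [eps / l * d >= 109 / (2 * eps)]. *)
Lemma slack_dominates_loss (R : realType) (eps l d : R) :
  0 < eps <= 9%:R / 10%:R -> 2%:R <= l ->
  109%:R * l * eps ^- 2 * ln (l * eps^-1) <= d -> 4%:R <= eps / l * d.
Proof.
move=> /andP[e0 e1] l2 le_d.
apply: le_trans (ler_wpM2l _ le_d); last by rewrite divr_ge0; lra.
have e1' : 1 <= eps^-1 by rewrite invf_ge1 //; lra.
have q2 : 2%:R <= l * eps^-1 by nra.
have ln2 : 2^-1 <= ln (l * eps^-1).
  have q0 : 0 < l * eps^-1 by lra.
  have := @le_ln1Dx R ((l * eps^-1)^-1 - 1).
  rewrite subrKC lnV // ltrBDr addrC subrr invr_gt0 => /(_ q0).
  have : (l * eps^-1)^-1 <= 2^-1 by rewrite lef_pV2 // posrE.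
  lra.
move: (ln _) ln2 => y ln2.
have -> : eps / l * (109%:R * l * eps ^- 2 * y) = 109%:R * eps^-1 * y.
  by field; rewrite !gt_eqF //; lra.
nra.
Qed.

(** Normalise the positive parts of the [a i - s]; their total is at least 1,
    so the normalisation only decreases them. *)
Lemma shifted_distribution (R : realFieldType) (I : finType)
    (a : I -> R) (s : R) :
  1 <= \sum_i (a i - s) ->
  exists p : I -> R,
    [/\ forall i, 0 <= p i <= 1, \sum_i p i = 1
      & forall i, 0 < p i -> p i <= a i - s].
Proof.
move=> sum_ge1; pose q i : R := Num.max 0 (a i - s).
have q0 i : 0 <= q i by rewrite le_max lexx.
have Q1 : 1 <= \sum_i q i.
  by apply: le_trans sum_ge1 _; apply: ler_sum => i _; rewrite le_max lexx orbT.
have Q0 : 0 < \sum_i q i by apply: lt_le_trans Q1.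
exists (fun i => q i / \sum_i q i); split.
- move=> i; rewrite divr_ge0 ?(ltW Q0) // ler_pdivrMr // mul1r.
  rewrite (bigD1 i) //= lerDl.
  exact: sumr_ge0.
- by rewrite -mulr_suml mulfV ?gt_eqF.
- move=> i; rewrite pmulr_lgt0 ?invr_gt0 // lt_max ltxx => /= pos.
  have -> : q i = a i - s by rewrite /q max_r // ltW.
  by rewrite ler_pdivrMr // ler_peMr // ltW.
Qed.

Theorem theorem19 (R : realType) (eps : R) (heps : 0 < eps <= 9%:R / 10%:R)
    (l : nat) (hl : (2 <= l)%N)
    (Lambda : l.-tuple R) (hLambda : excessive eps Lambda)
    (G : sgraph) (C : eqType)
    (alpha : C -> R) (halpha : tolerance_function Lambda alpha)
    (L : edge G -> l.-tuple C) (hL : Lambda_list_assignment Lambda alpha L)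
    (hdeg : Num.ceil (109%:R * l%:R * eps ^- 2 * ln (l%:R * eps^-1))
              <= (min_degree G)%:Z) :
  exists omega : edge G -> C, majority_colouring alpha L omega.
Proof.
have [Lambda01 sumLambda] := hLambda.
have l0 : 0 < l%:R :> R by rewrite ltr0n; lia.
have [p [p01 sum_p p_le]] : exists p : 'I_l -> R,
    [/\ forall i, 0 <= p i <= 1, \sum_i p i = 1
      & forall i, 0 < p i -> p i <= tnth Lambda i - eps / l%:R].
  apply: shifted_distribution.
  rewrite sumrB sumLambda sumr_const card_ord -[_ *+ l]mulr_natr.
  by rewrite divfK ?gt_eqF // addrK.
pose T := (edge G * 'I_l)%type.
pose col (t : T) := tnth (L t.1) t.2.
(* [C] may be infinite; only the colours occurring in a list matter, and they
   are numbered by their first occurrence in [codom col]. *)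
pose colours := codom col.
pose S (k : vertex G * 'I_(size colours)) : {set T} :=
  [set t : T | (k.1 \in val t.1) && (index (col t) colours == k.2)].
have idx_lt t : (index (col t) colours < size colours)%N.
  by rewrite index_mem codom_f.
have sparse t : (#|[set k | t \in S k]| <= 2)%N.
  rewrite -(edge_setP (valP t.1)).
  have inj : injective (fun v : vertex G => (v, Ordinal (idx_lt t))).
    by move=> u v [].
  rewrite -(card_imset _ inj); apply/subset_leq_card/subsetP => -[v j].
  rewrite !inE /= => /andP[vt /eqP jE].
  by apply/imsetP; exists v => //; congr pair; apply: val_inj.
have sum_x (e : edge G) : \sum_(t : T | t.1 == e) p t.2 = 1.
  transitivity (\sum_(e' | e' == e) \sum_i p i); last by rewrite big_pred1_eq.
  by rewrite pair_big /=; apply: eq_bigl => t; rewrite andbT.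
have [f [f1 fpos fload]] :=
  selection_with_sparse_loads sparse (fun t => p01 t.2) sum_x.
exists (fun e => col (f e)); split=> [e|v c].
  by rewrite -[e in L e]f1 mem_tnth.
have alpha0 : 0 < alpha c.
  by have /tnthP[i ->] := halpha c; case/andP: (Lambda01 i).
set c_at_v := [set e | _]; have [-> | [e0]] := set_0Vmem c_at_v.
  by rewrite cards0 mulr_ge0 // ltW.
rewrite inE => /andP[_ /eqP cE].
pose k := (v, Ordinal (idx_lt (f e0))).
have SE t : (t \in S k) = (v \in val t.1) && (col t == c).
  rewrite inE /=; congr andb; apply/eqP/eqP => [idxE|->]; last by rewrite cE.
  rewrite -cE -(nth_index (col t) (codom_f col t)) idxE nth_index //.
  exact: codom_f.
have alphaE t : col t = c -> tnth Lambda t.2 = alpha c.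
  by move=> <-; have [_ ->] := hL t.1.
apply: le_trans (le_trans (fload k) _).
  rewrite ler_nat; apply/subset_leq_card/subsetP => e.
  rewrite !inE => /andP[ve /eqP ce].
  by have := SE (f e); rewrite inE f1 ve ce eqxx => ->.
have S_le : (#|S k| <= degree v)%N.
  (* The colours of a list are distinct. *)
  have inj : {in S k &, injective (fun t : T => t.1)}.
    move=> [e i] [e' i']; rewrite !SE => /andP[_ /eqP ci].
    move=> /andP[_ /eqP ci'] /= ee'.
    rewrite -ee' in ci' *; congr pair; apply/eqP.
    have [uL _] := hL e; move: ci; rewrite -ci' => /eqP.
    by rewrite /col /= !(tnth_nth c) nth_uniq ?size_tuple.
  rewrite -(card_in_imset inj); apply/subset_leq_card/subsetP.
  move=> _ /imsetP[t tS ->].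
  by rewrite inE; move: tS; rewrite SE => /andP[].
(* The colour [c] is used, so its weight is positive. *)
have base : 0 <= alpha c - eps / l%:R.
  rewrite -(alphaE (f e0)) //; apply: le_trans (p_le _ (fpos e0)).
  exact: ltW (fpos e0).
have x_le t : t \in S k -> p t.2 <= alpha c - eps / l%:R.
  rewrite SE => /andP[_ /eqP ct]; have := p_le t.2; rewrite alphaE //.
  case: ltP => [_ /(_ isT)//|p_le0 _]; exact: le_trans base.
have d_ge : 109%:R * l%:R * eps ^- 2 * ln (l%:R * eps^-1) <= (degree v)%:R.
  have : 109%:R * l%:R * eps ^- 2 * ln (l%:R * eps^-1) <= (min_degree G)%:R.
    by move: hdeg; rewrite ceil_le_int.
  by move=> h; apply: le_trans h _; rewrite ler_nat min_degree_le.
have slack : 4%:R <= eps / l%:R * (degree v)%:R.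
  by apply: slack_dominates_loss d_ge => //; rewrite ler_nat.
apply: (@le_trans _ _ ((alpha c - eps / l%:R) * (degree v)%:R + 4%:R)).
  2: by rewrite mulrBl; lra.
rewrite lerD2r; apply: le_trans (ler_sum _ x_le) _.
by rewrite sumr_const -[_ *+ _]mulr_natr ler_wpM2l ?ler_nat.
Qed.
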